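(* Let $\lambda>0$ and let $\Omega_\lambda$ be the set of functions $f$ analytic in $\mathbb{D}=\{z:|z|<1\}$ with $f(0)=0$, $f'(0)=1$, such that $zf'(z)-f(z)=\lambda z^2\phi(z)$ for $z\in\mathbb{D}$ for some analytic $\phi$ in $\mathbb{D}$ with $|\phi(z)|\le1$. The radius of starlikeness of $\Omega_\lambda$ is $\frac{1}{2\lambda}$. Further, if $f\in\Omega_\lambda$, then for $z\in\mathbb{D}$, \[|z|-\lambda|z|^2\le|f(z)|\le|z|+\lambda|z|^2,\qquad 1-2\lambda|z|\le|f'(z)|\le1+2\lambda|z|.\] For $z\in\mathbb{D}$, $z\neq0$, equality occurs in both inequalities if and only if $f(z)=z+\lambda\eta z^2$ with $|\eta|=1$.
   Context: The radius of starlikeness of a class $E$ of normalized analytic functions on $\mathbb{D}$ is $\inf_{f\in E}\gamma_f$, where $\gamma_f$ is the largest $\gamma$ such that $f$ is starlike (i.e. $\mathrm{Re}(zf'(z)/f(z))>0$) in every disk $|z|<r$, $0<r\le\gamma$.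
   Formalization: The radius is stated as min(1, 1/(2λ)), since f lives only on the unit disk; in the equality clause, for each z≠0 a suitable η (not every η) gives equality in both upper bounds, and in both lower bounds when 2λ|z|≤1. *)

(* Defs.v *)
From HB Require Import structures.
From mathcomp Require Import all_boot all_order all_algebra.
From mathcomp Require Import all_classical all_reals all_analysis.
From mathcomp Require Import complex.
Set Implicit Arguments. Unset Strict Implicit. Unset Printing Implicit Defensive.
Import Order.TTheory GRing.Theory Num.Theory.
Import numFieldNormedType.Exports.
Local Open Scope ring_scope.
Local Open Scope complex_scope.
Local Open Scope classical_set_scope.

Section Defs.
Variable R : realType.
Local Notation C := R[i].

Definition cderiv (f : C -> C) (z : C) : C := @derive1 C C^o f z.

Definition unit_disk : set C := [set z | `|z| < 1].

(* analytic (= complex differentiable at every point) in the unit disk *)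
Definition analytic_in_disk (f : C -> C) : Prop :=
  forall z, `|z| < 1 -> derivable (f : C^o -> C^o) z 1.

Definition normalized (f : C -> C) : Prop :=
  analytic_in_disk f /\ f 0 = 0 /\ cderiv f 0 = 1.

Definition Omega (lam : R) (f : C -> C) : Prop :=
  normalized f /\
  exists phi : C -> C, analytic_in_disk phi /\
    (forall z, `|z| < 1 -> `|phi z| <= 1) /\
    (forall z, `|z| < 1 -> z * cderiv f z - f z = (lam%:C) * z ^+ 2 * phi z).

Definition starlike_in_disk (f : C -> C) (r : R) : Prop :=
  forall z : C, 0 < `|z| -> `|z| < r%:C -> 0 < complex.Re (z * cderiv f z / f z).

Definition gamma_star (f : C -> C) : R :=
  sup [set g : R | 0 < g <= 1 /\
                   (forall r : R, 0 < r <= g -> starlike_in_disk f r)].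

Definition radius_starlike (E : (C -> C) -> Prop) : R :=
  inf [set gamma_star f | f in E].

End Defs.

(* Main.v *)
(** Dividing [z f'(z) - f(z) = lam z^2 phi(z)] by [z^2] gives [(f(z)/z)' = lam phi(z)],
    so the mean value inequality on the segment from [0] to [z] yields
    [|f(z)/z - 1| <= lam |z|].  The growth and distortion bounds, and starlikeness for
    [|z| < 1/(2 lam)], follow from this estimate and
    [f'(z) = f(z)/z + lam z phi(z)].

    Equality in any of the four bounds at some [z0 <> 0] forces
    [|f(z0)/z0 - 1| = lam |z0|], that is, [s(z) = (f(z)/z - 1)/(lam z)] has modulus at
    most [1] and attains it at [z0].  Since [f(z)/z] is a primitive of the
    differentiable function [lam phi], [s] has second order Taylor expansions off [0].
    This regularity suffices for an elementary maximum principle (perturb by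
    [eps |z|^2] and sum over four symmetric increments), so no Cauchy theory is needed
    to conclude that [s] is constant. *)

Require Import Defs.
From HB Require Import structures.
From mathcomp Require Import all_boot all_order all_algebra.
From mathcomp Require Import all_classical all_reals all_analysis.
From mathcomp Require Import complex ring lra.
Import Order.TTheory GRing.Theory Num.Theory.
Import numFieldNormedType.Exports.
Local Open Scope ring_scope.
Local Open Scope complex_scope.
Local Open Scope classical_set_scope.
Import ComplexField.Normc.
Set Implicit Arguments. Unset Strict Implicit. Unset Printing Implicit Defensive.

(** * Real-valued modulus and real parts of complex numbers *)

Section ComplexModulus.
Variable R : realType.
Local Notation C := R[i].
Implicit Types z w : C.

Lemma normrC z : `|z| = (normc z)%:C. Proof. by []. Qed.

Lemma normc_ge0 z : 0 <= normc z.
Proof. by rewrite -lecR -normrC normr_ge0. Qed.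

Lemma normc_eq0 z : (normc z == 0) = (z == 0).
Proof. by rewrite -(inj_eq (@complexI R)) -normrC normr_eq0. Qed.

Lemma normc_gt0 z : (0 < normc z) = (z != 0).
Proof. by rewrite lt_def normc_eq0 normc_ge0 andbT. Qed.

Lemma normcX z n : normc (z ^+ n) = normc z ^+ n.
Proof.
by elim: n => [|n IH]; rewrite ?expr0 ?normc1 // !exprS normcM IH.
Qed.

Lemma normc_real (x : R) : normc x%:C = `|x|.
Proof. by rewrite /= expr0n addr0 sqrtr_sqr. Qed.

Lemma normc_distC z w : normc (z - w) = normc (w - z).
Proof. by rewrite -(normcN (z - w)) opprB. Qed.

Lemma le_normcB z w : normc z - normc w <= normc (z - w).
Proof. by rewrite lerBlDr -[X in normc X](subrK w) le_normcD. Qed.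

Lemma Re_le_normc z : complex.Re z <= normc z.
Proof.
by apply: le_trans (ler_norm _) _; rewrite -lecR -normrC; exact: normc_ge_Re.
Qed.

Lemma normr_Re_le z : `|complex.Re z| <= normc z.
Proof. by rewrite -lecR -normrC; exact: normc_ge_Re. Qed.

Lemma normc_sqr z : normc z ^+ 2 = complex.Re z ^+ 2 + complex.Im z ^+ 2.
Proof. by case: z => a b; rewrite /= sqr_sqrtr // addr_ge0 // sqr_ge0. Qed.

Lemma ReD z w : complex.Re (z + w) = complex.Re z + complex.Re w.
Proof. by case: z; case: w. Qed.

Lemma ReB z w : complex.Re (z - w) = complex.Re z - complex.Re w.
Proof. by case: z; case: w. Qed.

Lemma ReZ (t : R) z : complex.Re (t%:C * z) = t * complex.Re z.
Proof. by case: z => a b /=; rewrite mul0r subr0. Qed.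

Lemma Re_real_complex (t : R) : complex.Re t%:C = t.
Proof. by []. Qed.

(** Turns a modulus into the real part of a rotated value, so that real-variable theorems apply to
    [Re (c * z)]. *)
Lemma normc_rotation z : exists2 c : C, normc c = 1 & c * z = (normc z)%:C.
Proof.
have [->|z0] := eqVneq z 0; first by exists 1; rewrite ?normc1 // mulr0 normc0.
exists ((normc z)%:C / z); last by rewrite divfK.
by rewrite normcM normcV normc_real ger0_norm ?normc_ge0// divff ?normc_eq0.
Qed.

End ComplexModulus.

(** * Limits and complex derivatives with real tolerances *)

Section ComplexLimits.
Variable R : realType.
Local Notation C := R[i].
Local Notation Co := (R[i]^o).

(** Positive elements of [R[i]] are exactly the embedded positive reals, so tolerances may be taken
    in [R], where the order is total and [lra] works. *)
Lemma cvg_normcP (T : Type) (F : set_system T) (FF : Filter F)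
    (f : T -> C) (l : C) :
  ((f : T -> Co) @ F --> (l : Co)) <->
  (forall e : R, 0 < e -> \forall x \near F, normc (f x - l) < e).
Proof.
split.
- move=> /cvgrPdist_lt H e e0.
  have /H : 0 < e%:C :> Co by rewrite ltcR.
  by apply: filterS => x; rewrite normrC ltcR normc_distC.
- move=> H; apply/cvgrPdist_lt => /= e e0.
  have eR : e = (complex.Re e)%:C by rewrite RRe_real // gtr0_real.
  have : 0 < complex.Re e by rewrite -ltcR -eR.
  by move=> /H; apply: filterS => x; rewrite eR normrC ltcR normc_distC.
Qed.

Lemma near0_normcP (P : C -> Prop) :
  (\forall h \near (0 : Co)^', P h) <->
  exists2 d : R, 0 < d & forall h, h != 0 -> normc h < d -> P h.
Proof.
split.
- rewrite /dnbhs near_withinE => /(nbhs_normP (0 : Co)) [e /= e0 H].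
  have eR : e = (complex.Re e)%:C by rewrite RRe_real // gtr0_real.
  exists (complex.Re e); first by rewrite -ltcR -eR.
  move=> h h0 hd; apply: H => //=.
  by rewrite sub0r normrN eR normrC ltcR.
- move=> [d d0 H]; rewrite /dnbhs near_withinE.
  apply/(nbhs_normP (0 : Co)); exists (d%:C); first by rewrite /= ltcR.
  move=> h /=; rewrite sub0r normrN normrC ltcR => hd h0; exact: H.
Qed.

Definition cvg0 (f : C -> C) (l : C) : Prop :=
  (f : Co -> Co) @ (0 : Co)^' --> (l : Co).

Lemma cvg0_normcP (f : C -> C) (l : C) :
  cvg0 f l <->
  (forall e : R, 0 < e -> exists2 d : R, 0 < d &
     forall h, h != 0 -> normc h < d -> normc (f h - l) < e).
Proof.
rewrite /cvg0 cvg_normcP; split => H e /H.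
- by move=> /near0_normcP.
- by move=> ?; apply/near0_normcP.
Qed.

Lemma cvg0_cst (l : C) : cvg0 (fun=> l) l.
Proof. exact: (cvg_cst (l : Co)). Qed.

Lemma cvg0_id : cvg0 id 0.
Proof. by apply/cvg0_normcP => e e0; exists e => // h _; rewrite subr0. Qed.

Lemma cvg0D f g a b : cvg0 f a -> cvg0 g b -> cvg0 (fun h => f h + g h) (a + b).
Proof. move=> Hf Hg; exact: (cvgD Hf Hg). Qed.

Lemma cvg0M f g a b : cvg0 f a -> cvg0 g b -> cvg0 (fun h => f h * g h) (a * b).
Proof. move=> Hf Hg; exact: (@cvgM _ _ _ _ (f : C -> Co) g a b Hf Hg). Qed.

Lemma cvg0V f a : a != 0 -> cvg0 f a -> cvg0 (fun h => (f h)^-1) a^-1.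
Proof. move=> a0 Hf; exact: (@cvgV _ _ _ _ (f : C -> Co) a a0 Hf). Qed.

Lemma cvg0_eq (d : R) f g l : 0 < d ->
  (forall h, h != 0 -> normc h < d -> f h = g h) -> cvg0 f l -> cvg0 g l.
Proof.
move=> d0 E /cvg0_normcP H; apply/cvg0_normcP => e /H [d' d'0 Hd].
exists (Num.min d d'); first by rewrite lt_min d0.
by move=> h h0; rewrite lt_min => /andP[hd hd']; rewrite -E // Hd.
Qed.

(** Stated as a limit relation, so that derivative rules become limits of explicit quotients checked
    by [field]; [has_cderivE] and [derivable_has_cderiv] link it to [derivable] and [cderiv]. *)
Definition has_cderiv (f : C -> C) (z d : C) : Prop :=
  cvg0 (fun h => (f (z + h) - f z) / h) d.

Lemma has_cderivE f z d : has_cderiv f z d ->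
  derivable (f : Co -> Co) z 1 /\ cderiv f z = d.
Proof.
rewrite /has_cderiv /cvg0 => H.
have E : (fun h : C => h^-1 *: (((f : Co -> Co) \o shift (z : Co)) (h *: (1 : Co)) - f z) : Co)
   = (fun h : Co => (f (z + h) - f z) / h : Co).
  apply/funext => h /=.
  by rewrite /GRing.scale /= mulr1 [h + z]addrC [RHS]mulrC.
split; first by rewrite /derivable; apply/cvg_ex; exists d; rewrite E.
by rewrite /cderiv derive1E /derive E; have := cvg_lim (@norm_hausdorff _ Co) H; exact.
Qed.

Lemma derivable_has_cderiv f z : derivable (f : Co -> Co) z 1 ->
  has_cderiv f z (cderiv f z).
Proof.
rewrite /cderiv derive1E /derive /derivable /has_cderiv /cvg0.
suff -> : (fun h : C => h^-1 *: (((f : Co -> Co) \o shift (z : Co)) (h *: (1 : Co)) - f z) : Co)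
   = (fun h : Co => (f (z + h) - f z) / h : Co) by [].
apply/funext => h /=.
by rewrite /GRing.scale /= mulr1 [h + z]addrC [RHS]mulrC.
Qed.

End ComplexLimits.

Arguments cvg0_id {R}.
Arguments cvg0_cst {R} l.
Arguments cvg0D {R f g a b}.
Arguments cvg0M {R f g a b}.
Arguments cvg0V {R f a}.

(** * Mean value inequality on complex segments *)

Section MeanValue.
Variable R : realType.
Local Notation C := R[i].

Definition ccontinuous (f : C -> C) (z : C) : Prop :=
  cvg0 (fun h => f (z + h)) (f z).

Lemma has_cderiv_ccontinuous f z d : has_cderiv f z d -> ccontinuous f z.
Proof.
move=> H.
have := cvg0D (cvg0M H cvg0_id) (cvg0_cst (f z)).
rewrite mulr0 add0r; apply: (@cvg0_eq _ 1) => // h h0 _.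
by rewrite divfK // subrK.
Qed.

Lemma is_derive_line (g : C -> C) (c a v d : C) (t : R) :
  v != 0 -> has_cderiv g (a + t%:C * v) d ->
  is_derive t (1 : R) (fun s : R => complex.Re (c * g (a + s%:C * v)))
    (complex.Re (c * d * v)).
Proof.
move=> v0 /cvg0_normcP H; set F := fun s : R => _.
have nv : 0 < normc v by rewrite normc_gt0.
suff L : (fun h : R => h^-1 *: ((F \o shift t) (h *: (1 : R)) - F t))
    @ (0 : R)^' --> complex.Re (c * d * v).
  apply: DeriveDef; first by rewrite /derivable; apply/cvg_ex; exists (complex.Re (c * d * v)).
  by rewrite /derive; apply: cvg_lim => //; exact: norm_hausdorff.
apply/cvgrPdist_lt => e e0.
(* The [+ 1] keeps the divisor positive even when [c = 0]. *)
have k0 : 0 < normc (c * v) + 1 by rewrite ltr_wpDl // normc_ge0.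
have [d' d0 Hd] := H _ (divr_gt0 e0 k0).
rewrite /dnbhs near_withinE; apply/(nbhs_normP (0 : R)).
exists (d' / normc v); first by rewrite /= divr_gt0.
move=> h /=; rewrite sub0r normrN ltr_pdivlMr // => hd h0.
have hv0 : h%:C * v != 0 by rewrite mulf_neq0 // (inj_eq (@complexI R)).
have {Hd} := Hd _ hv0; rewrite normcM normc_real => /(_ hd).
rewrite ltr_pdivlMr // => Hd.
rewrite /F /shift /= /GRing.scale /= mulr1.
have -> : a + (h + t)%:C * v = a + t%:C * v + h%:C * v.
  by rewrite rmorphD /= mulrDl -addrA [h%:C * v + _]addrC.
set w := a + _ * v.
(* The error of the real quotient is the real part of [c * v] times the error of the complex
   quotient. *)
have -> : complex.Re (c * d * v) - h^-1 * (complex.Re (c * g (w + h%:C * v)) - complex.Re (c * g w))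
  = complex.Re (c * v * - ((g (w + h%:C * v) - g w) / (h%:C * v) - d)).
  rewrite -ReB -ReZ -ReB fmorphV; congr complex.Re; field.
  by rewrite v0 (inj_eq (@complexI R)) h0.
apply: le_lt_trans (normr_Re_le _) _.
rewrite normcM normcN; apply: le_lt_trans Hd; rewrite mulrC.
by rewrite ler_wpM2l ?normc_ge0 // lerDl.
Qed.

Lemma continuous_line (g : C -> C) (c a v : C) (t : R) :
  v != 0 -> ccontinuous g (a + t%:C * v) ->
  {for t, continuous (fun s : R => complex.Re (c * g (a + s%:C * v)))}.
Proof.
move=> v0 /cvg0_normcP H.
have nv : 0 < normc v by rewrite normc_gt0.
apply/cvgrPdist_lt => e e0.
have k0 : 0 < normc c + 1 by rewrite ltr_wpDl // normc_ge0.
have [d' d0 Hd] := H _ (divr_gt0 e0 k0).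
apply/(nbhs_normP (t : R)); exists (d' / normc v); first by rewrite /= divr_gt0.
move=> s /=; rewrite ltr_pdivlMr // => hd.
have [->|st] := eqVneq s t; first by rewrite subrr normr0.
have hv0 : (s - t)%:C * v != 0 by rewrite mulf_neq0 // (inj_eq (@complexI R)) subr_eq0.
have {Hd} := Hd _ hv0; rewrite normcM normc_real distrC => /(_ hd).
have -> : a + t%:C * v + (s - t)%:C * v = a + s%:C * v.
  by rewrite rmorphB /=; ring.
rewrite ltr_pdivlMr // => Hd.
rewrite -ReB -mulrBr; apply: le_lt_trans (normr_Re_le _) _.
rewrite normcM normc_distC; apply: le_lt_trans Hd; rewrite mulrC.
by rewrite ler_wpM2l ?normc_ge0 // lerDl.
Qed.

(** Rotate the increment onto the nonnegative axis and apply the real mean value theorem to the real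
    part. Only continuity is asked at the endpoints, because [zquot f] will be known at [0] only as
    a continuous function. *)
Lemma segment_mean_value (g dg : C -> C) (a v : C) (M : R) :
  (forall t : R, 0 <= t <= 1 -> ccontinuous g (a + t%:C * v)) ->
  (forall t : R, 0 < t < 1 ->
     has_cderiv g (a + t%:C * v) (dg (a + t%:C * v)) /\
     normc (dg (a + t%:C * v)) <= M) ->
  normc (g (a + v) - g a) <= M * normc v.
Proof.
move=> cg dg1; have [->|v0] := eqVneq v 0.
  by rewrite addr0 subrr normc0 mulr0.
have [c c1 cE] := normc_rotation (g (a + v) - g a).
have [||t] := @MVT R (fun s : R => complex.Re (c * g (a + s%:C * v)))
   (fun s : R => complex.Re (c * dg (a + s%:C * v) * v)) 0 1 ltr01.
- move=> x; rewrite in_itv /= => xI.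
  by apply: is_derive_line => //; case: (dg1 _ xI).
- apply: continuous_in_subspaceT => x; rewrite inE /= in_itv /= => xI.
  exact: continuous_line (cg _ xI).
rewrite in_itv /= => tI; rewrite mul1r mul0r addr0 subr0 mulr1 -ReB -mulrBr cE.
rewrite Re_real_complex => ->.
apply: le_trans (Re_le_normc _) _; rewrite !normcM c1 mul1r.
by apply: ler_wpM2r; [exact: normc_ge0|case: (dg1 _ tI)].
Qed.

End MeanValue.

(** * Elementary maximum principle on compact sets *)

Section MaximumPrinciple.
Variable R : realType.
Local Notation C := R[i].

Lemma near_pair (p : R * R) (P : C -> Prop) :
  (exists2 d : R, 0 < d & forall w, normc (w - (p.1 +i* p.2)) < d -> P w) ->
  \forall q \near p, P (q.1 +i* q.2).
Proof.
(* The product norm is the maximum norm: coordinates below [d / 2] give modulus below [d]. *)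
move=> [d d0 H]; apply/(nbhs_normP p); exists (d / 2); first by rewrite /= divr_gt0.
move=> q /=; rewrite prod_normE /= gt_max => /andP[h1 h2].
apply: H; rewrite normc_distC /=.
set a := p.1 - q.1 in h1 *; set b := p.2 - q.2 in h2 *.
rewrite -(@ltr_pXn2r _ 2) // ?nnegrE ?sqrtr_ge0 ?ltW //.
rewrite sqr_sqrtr ?addr_ge0 ?sqr_ge0 //.
have := normr_ge0 a; have := normr_ge0 b.
rewrite -(real_normK (num_real a)) -(real_normK (num_real b)); nra.
Qed.

(** The plane is identified with [R * R], where a closed subset of the box of half-side [r] is
    compact and the extreme value theorem applies. *)
Lemma complex_EVT_max (A : set C) (u : C -> R) (r : R) (z0 : C) :
  A z0 -> (forall z, A z -> normc z <= r) ->
  (forall z, ~ A z ->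
     exists2 d : R, 0 < d & forall w, normc (w - z) < d -> ~ A w) ->
  (forall z, A z -> forall e : R, 0 < e ->
     exists2 d : R, 0 < d & forall w, normc (w - z) < d -> `|u w - u z| < e) ->
  exists2 m, A m & forall z, A z -> u z <= u m.
Proof.
move=> Az0 Ar Acl uc.
pose K : set (R * R) := [set p | A (p.1 +i* p.2)].
have Kcl : closed K.
  rewrite -[K]setCK; apply: open_closedC; rewrite openE => p /= Kp.
  exact/(near_pair (P := fun w => ~ A w))/Acl.
have Kc : compact K.
  apply: (@subclosed_compact _ K (`[- r, r] `*` `[- r, r])) => //.
    exact: compact_setX (@segment_compact _ _ _) (@segment_compact _ _ _).
  move=> [a b] /= /Ar H; rewrite /= !in_itv /= -!ler_norml.
  have N : normc (a +i* b) ^+ 2 <= r ^+ 2.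
    by rewrite ler_pXn2r // nnegrE ?normc_ge0 // (le_trans (normc_ge0 _) H).
  have r0 := le_trans (normc_ge0 _) H.
  rewrite normc_sqr /= in N.
  by split; rewrite -(@ler_pXn2r _ 2) // ?nnegrE // real_normK ?num_real //;
    apply: le_trans N; rewrite ?lerDl ?lerDr sqr_ge0.
have K0 : K !=set0 by exists (complex.Re z0, complex.Im z0); rewrite /K /=; case: (z0) Az0.
have uK : {within K, continuous (fun p : R * R => u (p.1 +i* p.2))}.
  apply: continuous_in_subspaceT => p; rewrite inE => Kp.
  apply/cvgrPdist_lt => e e0; apply: (near_pair (P := fun w => `|u _ - u w| < e)).
  by have [d d0 H] := uc _ Kp _ e0; exists d => // w /H; rewrite distrC.
have [p] := compact_EVT_max K0 Kc uK; rewrite inE => Kp Hp.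
exists (p.1 +i* p.2) => // -[a b] Az.
by have := Hp (a, b); apply; rewrite inE.
Qed.

(** Second order Taylor expansion at a single point. Both coefficients are complex numbers, so
    rotating the increment by [k] multiplies the terms by [k] and [k ^+ 2]. *)
Definition peano2 (W : C -> C) (z : C) : Prop :=
  exists a l, cvg0 (fun h => (W (z + h) - W z - a * h) / h ^+ 2) l.

Lemma normc_sqr_continuous (z : C) (e : R) : 0 < e ->
  exists2 d : R, 0 < d & forall w, normc (w - z) < d ->
    `|normc w ^+ 2 - normc z ^+ 2| < e.
Proof.
move=> e0; have k0 : 0 < 2 * normc z + 1 by have := normc_ge0 z; lra.
(* The difference of squares factors, and [normc w + normc z] is below [2 * normc z + 1] once [w] is
   within [1] of [z]. *)
exists (Num.min 1 (e / (2 * normc z + 1))); first by rewrite lt_min ltr01 divr_gt0.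
move=> w; rewrite lt_min => /andP[h1]; rewrite ltr_pdivlMr // => h2.
have := le_normcB w z; have := le_normcB z w; rewrite normc_distC.
have := normc_ge0 w; have := normc_ge0 z; have := normc_ge0 (w - z).
move: (normc (w - z)) (normc z) (normc w) h1 h2 => d x y h1 h2 d0 x0 y0 e1 e2.
rewrite ltr_norml; apply/andP; split; nra.
Qed.

(* Each of the four points [m + t k], [k^4 = 1], gives one inequality; the first
   and second order terms of [W] cancel in the sum because [sum k = sum k^2 = 0]. *)
Lemma weak_maximum_principle (A : set C) (r M : R) (W : C -> C) :
  (forall z, A z -> normc z <= r) ->
  (forall z, ~ A z ->
     exists2 d : R, 0 < d & forall w, normc (w - z) < d -> ~ A w) ->
  (forall z, A z -> ccontinuous W z) ->
  (forall z, A z -> M < normc (W z) ->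
     (exists2 d : R, 0 < d & forall w, normc (w - z) < d -> A w) /\
     peano2 W z) ->
  forall z, A z -> normc (W z) <= M.
Proof.
move=> Ar Acl Wc Wp z0 Az0; rewrite leNgt; apply/negP => Mlt.
have [c c1 cE] := normc_rotation (W z0).
have r0 : 0 <= r := le_trans (normc_ge0 _) (Ar _ Az0).
have r1 : 0 < r ^+ 2 + 1 by rewrite ltr_wpDl // sqr_ge0.
(* With this [e] the perturbation [e * normc z ^+ 2] stays below half of [normc (W z0) - M] on [A],
   so a maximum point [m] of [u] still satisfies [M < normc (W m)]. *)
pose e := (normc (W z0) - M) / (2 * (r ^+ 2 + 1)).
have e0 : 0 < e by rewrite divr_gt0 ?subr_gt0 // mulr_gt0.
have eE : e * (2 * (r ^+ 2 + 1)) = normc (W z0) - M.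
  by rewrite /e divfK // gt_eqF // mulr_gt0.
pose u z := complex.Re (c * W z) + e * normc z ^+ 2.
have uc z : A z -> forall e1 : R, 0 < e1 ->
     exists2 d : R, 0 < d & forall w, normc (w - z) < d -> `|u w - u z| < e1.
  move=> Az e1 e10.
  have e12 : 0 < e1 / 2 by lra.
  have /cvg0_normcP/(_ _ e12)[d1 d10 H1] := Wc _ Az.
  have [d2 d20 H2] := normc_sqr_continuous z (divr_gt0 e12 e0).
  exists (Num.min d1 d2); first by rewrite lt_min d10.
  move=> w; rewrite lt_min => /andP[w1 w2].
  have -> : u w - u z = complex.Re (c * (W w - W z)) + e * (normc w ^+ 2 - normc z ^+ 2).
    by rewrite /u mulrBr ReB; ring.
  have B1 : `|complex.Re (c * (W w - W z))| < e1 / 2.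
    apply: le_lt_trans (normr_Re_le _) _; rewrite normcM c1 mul1r.
    have [->|wz] := eqVneq w z; first by rewrite subrr normc0.
    by have := H1 (w - z); rewrite subr_eq0 [z + _]addrC subrK; apply.
  have B2 : `|e * (normc w ^+ 2 - normc z ^+ 2)| < e1 / 2.
    by rewrite normrM gtr0_norm // mulrC -ltr_pdivlMr // H2.
  by apply: le_lt_trans (ler_normD _ _) _; lra.
have [m Am mmax] := complex_EVT_max Az0 Ar Acl uc.
have WmM : M < normc (W m).
  have : u z0 <= u m by exact: mmax.
  rewrite /u cE Re_real_complex => um.
  have B : complex.Re (c * W m) <= normc (W m).
    by apply: le_trans (Re_le_normc _) _; rewrite normcM c1 mul1r.
  have Bm : normc m ^+ 2 <= r ^+ 2.
    by rewrite ler_pXn2r ?nnegrE ?normc_ge0 // Ar.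
  have := sqr_ge0 (normc z0); nra.
have [[d d0 dA] [a [l /cvg0_normcP aE]]] := Wp _ Am WmM.
have e2 : 0 < e / 2 by lra.
have {aE}[d' d'0 aE] := aE _ e2.
pose t := Num.min d d' / 2.
have t0 : 0 < t by rewrite divr_gt0 // lt_min d0.
have td : t < d /\ t < d'.
  have : Num.min d d' <= d by rewrite ge_min lexx.
  have : Num.min d d' <= d' by rewrite ge_min lexx orbT.
  by move: t0; rewrite /t; lra.
(* This is [u (m + t k) <= u m] with the expansion of [W] inserted; the remainder costs at most
   [e / 2 * t ^+ 2]. *)
have key k : normc k = 1 ->
    complex.Re (c * a * (t%:C * k)) + complex.Re (c * l * (t%:C * k) ^+ 2)
      - e / 2 * t ^+ 2 + e * (normc (m + t%:C * k) ^+ 2 - normc m ^+ 2) <= 0.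
  move=> k1; set h := t%:C * k.
  have nh : normc h = t by rewrite normcM k1 mulr1 normc_real gtr0_norm.
  have h0 : h != 0 by rewrite -normc_gt0 nh.
  have := aE h h0; rewrite nh => /(_ td.2).
  set Q := _ / h ^+ 2 => HQ.
  have WE : c * W (m + h) =
      c * W m + c * a * h + c * l * h ^+ 2 + c * (Q - l) * h ^+ 2.
    by rewrite /Q; field.
  have : u (m + h) <= u m.
    by apply/mmax/dA; rewrite addrAC subrr add0r nh td.1.
  rewrite /u WE !ReD.
  have : `|complex.Re (c * (Q - l) * h ^+ 2)| <= e / 2 * t ^+ 2.
    apply: le_trans (normr_Re_le _) _; rewrite normcM [normc (c * _)]normcM c1 mul1r normcX nh.
    by rewrite ler_wpM2r ?sqr_ge0 // ltW.
  rewrite ler_norml => /andP[]; lra.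
have n1 : normc (1 : C) = 1 := normc1 R.
have ni : normc ('i : C) = 1 by rewrite /= expr0n expr1n add0r sqrtr1.
have := key 1 n1; have := key (- 1); rewrite normcN => /(_ n1).
have := key ('i) ni; have := key (- 'i); rewrite normcN => /(_ ni).
rewrite !normc_sqr; case: (c * a) => p1 p2; case: (c * l) => q1 q2; case: (m) => x y.
(* In the sum of the four inequalities the squared moduli contribute [4 * e * t ^+ 2], against a
   total remainder of [2 * e * t ^+ 2]: a contradiction. *)
have T : 0 < e * t ^+ 2 by rewrite mulr_gt0 // exprn_gt0.
rewrite !expr2 /= in T *; nra.
Qed.

End MaximumPrinciple.

(** * Calculus of second order expansions *)

Section PeanoExpansions.
Variable R : realType.
Local Notation C := R[i].
Implicit Types (f g W : C -> C) (z y : C).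

Lemma addr_normc_lt_neq0 z h : normc h < normc z -> z + h != 0.
Proof.
by move=> hz; apply: contraTneq hz => /eqP; rewrite addr_eq0 => /eqP ->;
  rewrite normcN ltxx.
Qed.

Lemma peano2_ccontinuous W z : peano2 W z -> ccontinuous W z.
Proof.
move=> [a [l H]].
have := cvg0D (cvg0M (cvg0D (cvg0M H cvg0_id) (cvg0_cst a)) cvg0_id) (cvg0_cst (W z)).
rewrite !mulr0 add0r; apply: (@cvg0_eq _ 1) => // h h0 _.
by field.
Qed.

Lemma peano2_affine (a b : C) z : peano2 (fun w => a + b * w) z.
Proof.
exists b, 0; apply: cvg0_eq ltr01 _ (cvg0_cst 0) => h h0 _.
by field.
Qed.

(** With [k = z - y], the remainder of [1 / (k + h)] after its linear part is exactly
    [h^2 / (k^2 (k + h))]. *)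
Lemma peano2_inv y z : z != y -> peano2 (fun w => (w - y)^-1) z.
Proof.
move=> zy; have c0 : z - y != 0 by rewrite subr_eq0.
exists (- (z - y)^-2), (((z - y) ^+ 2)^-1 * (z - y)^-1).
have nz : 0 < normc (z - y) by rewrite normc_gt0.
have A : cvg0 (fun h => (z - y) + h) (z - y).
  by have := cvg0D (cvg0_cst (z - y)) cvg0_id; rewrite addr0.
have := cvg0M (cvg0_cst ((z - y) ^+ 2)^-1) (cvg0V c0 A).
apply: cvg0_eq nz _ => h h0 hd.
have k0 := addr_normc_lt_neq0 hd.
rewrite [z + h - y]addrAC; move: (z - y) c0 k0 => k k0 kh.
by field; rewrite k0 h0 kh.
Qed.

Lemma peano2M f g z : peano2 f z -> peano2 g z -> peano2 (fun w => f w * g w) z.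
Proof.
move=> [a [l Hf]] [b [m Hg]].
have gc : ccontinuous g z by apply: peano2_ccontinuous; exists b, m.
exists (a * g z + f z * b), (l * g z + a * b + f z * m).
have Hg1 := cvg0D (cvg0M Hg cvg0_id) (cvg0_cst b).
have := cvg0D (cvg0D (cvg0M Hf gc) (cvg0M (cvg0_cst a) Hg1)) (cvg0M (cvg0_cst (f z)) Hg).
rewrite mulr0 add0r; apply: cvg0_eq ltr01 _ => h h0 _.
by field.
Qed.

Lemma peano2X f z n : peano2 f z -> peano2 (fun w => f w ^+ n) z.
Proof.
move=> Hf; elim: n => [|n IH].
  have -> : (fun w => f w ^+ 0) = (fun w : C => 1 + 0 * w).
    by apply/funext => w; rewrite expr0 mul0r addr0.
  exact: peano2_affine.
have -> : (fun w => f w ^+ n.+1) = (fun w => f w * f w ^+ n).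
  by apply/funext => w; rewrite exprS.
exact: peano2M.
Qed.

Lemma peano2_add_cst (a : C) f z : peano2 f z -> peano2 (fun w => f w + a) z.
Proof.
move=> [b [l H]]; exists b, l; apply: cvg0_eq ltr01 _ H => h h0 _.
by congr (_ / _); ring.
Qed.

(** Subtracting the expected quadratic Taylor polynomial leaves [g], whose derivative at [w] is o(|w
    - z|); the mean value inequality then makes the increment of [g] o(|h|^2). *)
Lemma peano2_primitive (d0 : R) f (df : C -> C) z b : 0 < d0 ->
  (forall w, normc (w - z) < d0 -> has_cderiv f w (df w)) ->
  has_cderiv df z b -> peano2 f z.
Proof.
move=> d00 fd dfd; exists (df z), (b / 2); apply/cvg0_normcP => e e0.
have e2 : 0 < e / 2 by lra.
have /cvg0_normcP/(_ _ e2)[d1 d10 H] := dfd.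
exists (Num.min d0 d1); first by rewrite lt_min d00.
move=> h h0; rewrite lt_min => /andP[hd0 hd1].
pose g w := f w - df z * (w - z) - b / 2 * (w - z) ^+ 2.
pose dg w := df w - df z - b * (w - z).
have nh : 0 < normc h by rewrite normc_gt0.
have gd w : normc (w - z) < d0 -> has_cderiv g w (dg w).
  move=> /fd fw.
  have := cvg0D (cvg0D fw (cvg0_cst (- df z - b * (w - z))))
    (cvg0M (cvg0_cst (- (b / 2))) cvg0_id).
  rewrite mulr0 addr0 addrA; apply: cvg0_eq ltr01 _ => k k0 _.
  by rewrite /g; field.
have nt (t : R) : 0 <= t <= 1 -> normc (t%:C * h) <= normc h.
  move=> /andP[t0 t1].
  by rewrite normcM normc_real ger0_norm // ler_piMl ?normc_ge0.
have B : normc (g (z + h) - g z) <= e / 2 * normc h * normc h.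
  apply: (@segment_mean_value _ g dg) => t /andP[t0 t1].
    apply/has_cderiv_ccontinuous/gd.
    rewrite addrAC subrr add0r; apply: le_lt_trans hd0; apply: nt.
    by rewrite t0 t1.
  have tn : normc (t%:C * h) <= normc h by apply: nt; rewrite !ltW.
  split.
    by apply: gd; rewrite addrAC subrr add0r; exact: le_lt_trans hd0.
  have th0 : t%:C * h != 0 by rewrite mulf_neq0 // (inj_eq (@complexI R)) gt_eqF.
  have := H _ th0 (le_lt_trans tn hd1).
  rewrite /dg; move: (t%:C * h) th0 tn => k k0 kn /ltW Hk.
  have -> : df (z + k) - df z - b * (z + k - z) = ((df (z + k) - df z) / k - b) * k.
    by field.
  by rewrite normcM ler_pM ?normc_ge0.
have -> : (f (z + h) - f z - df z * h) / h ^+ 2 - b / 2 = (g (z + h) - g z) / h ^+ 2.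
  by rewrite /g; field.
rewrite normcM normcV normcX ltr_pdivrMr ?exprn_gt0 //.
apply: le_lt_trans B _; rewrite -mulrA -expr2 ltr_pM2r ?exprn_gt0 //; lra.
Qed.

End PeanoExpansions.

(** * Strong maximum principle on the punctured disk *)

Section PuncturedDisk.
Variable R : realType.
Local Notation C := R[i].

Lemma exprn_lt_eps (x e : R) : 0 <= x -> x < 1 -> 0 < e -> exists n, x ^+ n < e.
Proof.
move=> x0 x1 e0.
have /cvgrPdist_lt/(_ _ e0) : (fun n => x ^+ n) @ \oo --> (0 : R).
  by apply: cvg_expr; rewrite ger0_norm.
move=> [N _ /(_ N (leqnn N))]; rewrite sub0r normrN ger0_norm ?exprn_ge0 //.
by exists N.
Qed.

(** The sign of the right side tells whether the inverse Blaschke factor [b] used below has modulus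
    above [1] (inside the circle of radius [r]) or equal to [1] (on it). *)
Lemma blaschke_identity (r : R) (y z : C) :
  normc ((r ^+ 2)%:C - y^* * z) ^+ 2 - r ^+ 2 * normc (z - y) ^+ 2 =
  (r ^+ 2 - normc z ^+ 2) * (r ^+ 2 - normc y ^+ 2).
Proof. by rewrite !normc_sqr; case: y => a b; case: z => c d /=; ring. Qed.

(* If [|H y| < 1], compare [W = z H^q b^p] with [b] the inverse of the Blaschke
   factor of [|z| < r] at [y]: the factor [z] removes the puncture, a large [p]
   makes [|W z0|] exceed [r], hence the values on [|z| = r], and then a large [q]
   makes [W] small on a circle around [y]. *)
Lemma punctured_disk_maximum (H : C -> C) (z0 : C) :
  (forall z, z != 0 -> normc z < 1 -> normc (H z) <= 1) ->
  (forall z, z != 0 -> normc z < 1 -> peano2 H z) ->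
  z0 != 0 -> normc z0 < 1 -> normc (H z0) = 1 ->
  forall y, y != 0 -> normc y < 1 -> normc (H y) = 1.
Proof.
move=> H1 H2 z00 z01 Hz0 y y0 y1; apply/eqP; rewrite eq_le H1 //= leNgt.
apply/negP => Hy.
have yz0 : z0 != y by apply: contraTneq Hy => <-; rewrite Hz0 ltxx.
pose r := (Num.max (normc z0) (normc y) + 1) / 2.
have [r0 r1 zr yr] : [/\ 0 < r, r < 1, normc z0 < r & normc y < r].
  have : normc z0 <= Num.max (normc z0) (normc y) by rewrite le_max lexx.
  have : normc y <= Num.max (normc z0) (normc y) by rewrite le_max lexx orbT.
  have : Num.max (normc z0) (normc y) < 1 by rewrite gt_max z01.
  by rewrite /r; have := normc_ge0 y; split; lra.
clearbody r.
pose m := (normc (H y) + 1) / 2.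
have [m0 m1 Hm] : [/\ 0 <= m, m < 1 & 0 < m - normc (H y)].
  by rewrite /m; have := normc_ge0 (H y); split; lra.
clearbody m.
have /cvg0_normcP/(_ _ Hm)[d d0 Hd] := peano2_ccontinuous (H2 _ y0 y1).
have nzy : 0 < normc (z0 - y) by rewrite normc_gt0 subr_eq0.
pose rho := Num.min d (normc (z0 - y)) / 2.
have [rho0 rhod rhoz] : [/\ 0 < rho, rho < d & rho < normc (z0 - y)].
  have : Num.min d (normc (z0 - y)) <= d by rewrite ge_min lexx.
  have : Num.min d (normc (z0 - y)) <= normc (z0 - y) by rewrite ge_min lexx orbT.
  have : 0 < Num.min d (normc (z0 - y)) by rewrite lt_min d0.
  by rewrite /rho; split; lra.
clearbody rho.
have Hrho w : normc (w - y) = rho -> normc (H w) <= m.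
  move=> wy; have := Hd (w - y); rewrite wy -normc_gt0 wy rho0 => /(_ isT rhod).
  rewrite [y + _]addrC subrK => /ltW h; have := le_normcB (H w) (H y); lra.
pose b z := (r%:C)^-1 * ((r ^+ 2)%:C - y^* * z) * (z - y)^-1.
have bE z : normc (b z) = normc ((r ^+ 2)%:C - y^* * z) / (r * normc (z - y)).
  rewrite /b !normcM !normcV normc_real gtr0_norm // [(r * _)^-1]invfM.
  by rewrite mulrCA mulrA.
have b1 : 1 < normc (b z0).
  rewrite bE ltr_pdivlMr ?mulr_gt0 // mul1r.
  rewrite -(@ltr_pXn2r _ 2) // ?nnegrE ?normc_ge0 ?mulr_ge0 ?normc_ge0 ?ltW //.
  rewrite exprMn -subr_gt0 blaschke_identity mulr_gt0 // subr_gt0;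
  by rewrite ltr_pXn2r // ?nnegrE ?normc_ge0 ?ltW.
have b_out z : normc z = r -> normc (b z) <= 1.
  move=> zr'; have := blaschke_identity r y z.
  rewrite zr' subrr mul0r -exprMn => /eqP; rewrite subr_eq0 => /eqP E.
  have E' : normc ((r ^+ 2)%:C - y^* * z) = r * normc (z - y).
    apply/eqP; rewrite -(@eqrXn2 _ 2) // ?normc_ge0 ?mulr_ge0 ?normc_ge0 ?ltW //.
    by rewrite E.
  rewrite bE E' ler_pdivrMr ?mul1r // mulr_gt0 // normc_gt0 subr_eq0.
  by apply: contraTneq yr => <-; rewrite zr' ltxx.
(* The numerator of [b] is at most [r ^+ 2 + normc y * normc z], hence at most [2 * r ^+ 2]. *)
have b_in z : normc z <= r -> normc (z - y) = rho -> normc (b z) <= 2 * r / rho.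
  move=> zr' zy; rewrite bE zy ler_pdivrMr ?mulr_gt0 //.
  have -> : 2 * r / rho * (r * rho) = r ^+ 2 + r * r by field; rewrite gt_eqF.
  apply: le_trans (le_normcD _ _) _; rewrite normcN normc_real ger0_norm ?sqr_ge0 //.
  rewrite lerD2l normcM.
  have -> : normc y^* = normc y by apply: (@complexI R); rewrite -!normrC normcJ.
  by rewrite ler_pM ?normc_ge0 // ltW.
have nz0 : 0 < normc z0 by rewrite normc_gt0.
have b0 : 0 < normc (b z0) by lra.
(* This says that [normc z0 * normc (b z0) ^+ p] exceeds [r]. *)
have [p Hp] : exists p, (normc (b z0))^-1 ^+ p < normc z0 / r.
  by apply: exprn_lt_eps; rewrite ?invr_ge0 ?invf_lt1 ?divr_gt0 // ltW.
have B0 : 0 < (2 * r / rho) ^+ p by rewrite exprn_gt0 // divr_gt0 // mulr_gt0.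
(* On the circle around [y] this forces [normc (H z ^+ q * b z ^+ p) <= 1], hence
   [normc (W z) <= normc z <= r]. *)
have [q Hq] : exists q, m ^+ q < ((2 * r / rho) ^+ p)^-1.
  by apply: exprn_lt_eps; rewrite ?invr_gt0.
pose W z := z * (H z ^+ q * b z ^+ p).
have WE z : normc (W z) = normc z * (normc (H z) ^+ q * normc (b z) ^+ p).
  by rewrite /W normcM [normc (_ ^+ q * _)]normcM !normcX.
have Wz0 : r < normc (W z0).
  rewrite WE Hz0 expr1n mul1r; move: Hp.
  by rewrite exprVn ltr_pdivlMr // ltr_pdivrMl ?exprn_gt0 // mulrC.
suff : normc (W z0) <= r by rewrite leNgt Wz0.
(* A closed disk with an open disk around [y] removed, which excludes the pole of [b]. On both
   bounding circles [W] has modulus at most [r], so points of [A] where it is larger are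
   interior. *)
pose A : set C := [set z | normc z <= r /\ rho <= normc (z - y)].
have Ay z : A z -> z != y.
  by move=> [_ zy]; rewrite -subr_eq0 -normc_gt0; exact: lt_le_trans zy.
have bP z : z != y -> peano2 b z.
  move=> zy; have := peano2M
    (peano2_affine (r%:C^-1 * (r ^+ 2)%:C) (- (r%:C^-1 * y^* )) z) (peano2_inv zy).
  by congr (peano2 _ z); apply/funext => w; rewrite /b; congr (_ * _); ring.
have WP z : A z -> z != 0 -> peano2 W z.
  move=> Az z0'; have z1 : normc z < 1 by apply: le_lt_trans r1; case: Az.
  have idP := peano2_affine 0 1 z.
  have := peano2M idP (peano2M (peano2X q (H2 _ z0' z1)) (peano2X p (bP _ (Ay _ Az)))).
  by congr (peano2 _ z); apply/funext => w; rewrite /W add0r mul1r.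
apply: (@weak_maximum_principle _ A r r W) => //.
- by move=> z [].
- move=> z nA.
  have [zr'|zr'] := ltP r (normc z).
    exists (normc z - r); first lra.
    by move=> w wz [wr _]; have := le_normcB z w; rewrite normc_distC; lra.
  have zy : normc (z - y) < rho.
    by rewrite ltNge; apply/negP => zy; apply: nA; split.
  exists (rho - normc (z - y)); first lra.
  move=> w wz [_ wy]; have := le_normcD (w - z) (z - y).
  by rewrite addrA subrK; lra.
(* At [0] only boundedness of [H] nearby is available; the factor [z] makes [W] tend to [0], and no
   expansion is required there since [W] vanishes. *)
- move=> z Az; have [z0'|z0'] := eqVneq z 0; last exact/peano2_ccontinuous/WP.
  rewrite z0' /ccontinuous {2}/W mul0r; apply/cvg0_normcP => e e0.
  have bX : ccontinuous (fun w => b w ^+ p) 0.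
    by apply/peano2_ccontinuous/peano2X/bP; rewrite eq_sym.
  have := cvg0M cvg0_id bX; rewrite mul0r => /cvg0_normcP/(_ _ e0)[d1 d10 Hd1].
  exists (Num.min 1 d1); first by rewrite lt_min ltr01.
  move=> h h0; rewrite lt_min => /andP[h1 hd1].
  have := Hd1 _ h0 hd1; rewrite !subr0 add0r WE normcM normcX.
  apply: le_lt_trans; rewrite ler_wpM2l ?normc_ge0 //.
  rewrite ler_piMl ?exprn_ge0 ?normc_ge0 //.
  by rewrite exprn_ile1 ?normc_ge0 // H1.
- move=> z Az Wr.
  have z0' : z != 0.
    by apply: contraTneq Wr => ->; rewrite WE normc0 mul0r -leNgt ltW.
  split; last exact: WP.
  have [zr' zy] := Az.
  have z1 : normc z < 1 := le_lt_trans zr' r1.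
  have zr2 : normc z < r.
    rewrite lt_neqAle zr' andbT; apply: contraTneq Wr => E; rewrite -leNgt WE E.
    rewrite ler_piMr ?(ltW r0) // mulr_ile1 ?exprn_ge0 ?normc_ge0 //.
      by rewrite exprn_ile1 ?normc_ge0 // H1.
    by rewrite exprn_ile1 ?normc_ge0 // b_out.
  have zy2 : rho < normc (z - y).
    rewrite lt_neqAle zy andbT; apply: contraTneq Wr => E; rewrite -leNgt WE.
    rewrite -[leRHS]mulr1 ler_pM ?mulr_ge0 ?exprn_ge0 ?normc_ge0 //.
    apply: (@le_trans _ _ (m ^+ q * (2 * r / rho) ^+ p)).
      rewrite ler_pM ?exprn_ge0 ?normc_ge0 //.
        by rewrite lerXn2r ?nnegrE ?normc_ge0 // Hrho.
      rewrite lerXn2r ?nnegrE ?normc_ge0 ?b_in //.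
      by rewrite divr_ge0 ?mulr_ge0 ?ltW.
    by rewrite -ler_pdivlMr // mul1r ltW.
  exists (Num.min (r - normc z) (normc (z - y) - rho)).
    by rewrite lt_min !subr_gt0 zr2.
  move=> w; rewrite lt_min => /andP[w1 w2]; split.
    by have := le_normcB w z; lra.
  have := le_normcD (z - w) (w - y); rewrite addrA subrK normc_distC; lra.
- by split; apply: ltW.
Qed.

End PuncturedDisk.

(** * The class [Omega]: growth, distortion, extremal functions, starlikeness *)

Section OmegaClass.
Variable R : realType.
Local Notation C := R[i].

Lemma normr_lt1 (z : C) : (`|z| < 1) = (normc z < 1).
Proof. by rewrite normrC -[1]/((1 : R)%:C) ltcR. Qed.

Lemma has_cderiv_quadratic (a z : C) :
  has_cderiv (fun w => w + a * w ^+ 2) z (1 + 2 * a * z).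
Proof.
have := cvg0D (cvg0_cst (1 + 2 * a * z)) (cvg0M (cvg0_cst a) cvg0_id).
rewrite mulr0 addr0; apply: cvg0_eq ltr01 _ => h h0 _.
by field.
Qed.
Arguments has_cderiv_quadratic a z : clear implicits.

Lemma cderiv_quadratic (a z : C) :
  cderiv (fun w => w + a * w ^+ 2) z = 1 + 2 * a * z.
Proof. by have [] := has_cderivE (has_cderiv_quadratic a z). Qed.

Lemma Omega_quadratic (lam : R) (eta : C) : `|eta| = 1 ->
  Omega lam (fun w => w + lam%:C * eta * w ^+ 2).
Proof.
move=> eta1; split; first split.
- by move=> z _; have [] := has_cderivE (has_cderiv_quadratic (lam%:C * eta) z).
- by rewrite cderiv_quadratic expr0n !mulr0 !addr0.
exists (fun=> eta); split; first by move=> z _; exact: derivable_cst.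
split=> z _; first by rewrite eta1.
by rewrite cderiv_quadratic; ring.
Qed.

(* [f z / z], with its removable singularity filled in for normalized [f]. *)
Definition zquot (f : C -> C) (z : C) : C := if z == 0 then 1 else f z / z.

Lemma has_cderiv_zquot f z d : z != 0 -> has_cderiv f z d ->
  has_cderiv (zquot f) z ((z * d - f z) / z ^+ 2).
Proof.
move=> z0 fd.
have nz : 0 < normc z by rewrite normc_gt0.
have A : cvg0 (fun h => z + h) z by have := cvg0D (cvg0_cst z) cvg0_id; rewrite addr0.
have := cvg0M (cvg0D (cvg0M (cvg0_cst z) fd) (cvg0_cst (- f z)))
  (cvg0V (mulf_neq0 z0 z0) (cvg0M (cvg0_cst z) A)).
rewrite -expr2; apply: cvg0_eq nz _ => h h0 hz.
have zh := addr_normc_lt_neq0 hz.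
rewrite /zquot (negPf z0) (negPf zh); field.
by rewrite z0 h0 zh.
Qed.

Lemma ccontinuous_zquot0 f : f 0 = 0 -> has_cderiv f 0 1 -> ccontinuous (zquot f) 0.
Proof.
move=> f0; rewrite /ccontinuous {2}/zquot eqxx; apply: cvg0_eq ltr01 _ => h h0 _.
by rewrite /zquot add0r (negPf h0) f0 subr0.
Qed.

(** Repackages membership in terms of [zquot f]; the last clause also covers [z = 0], so the bounds
    need no case split. *)
Lemma Omega_zquot (lam : R) f : Omega lam f ->
  exists2 phi : C -> C,
    (forall z, normc z < 1 ->
       has_cderiv phi z (cderiv phi z) /\ normc (phi z) <= 1) &
    [/\ ccontinuous (zquot f) 0,
        forall z, z != 0 -> normc z < 1 ->
          has_cderiv (zquot f) z (lam%:C * phi z) &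
        forall z, normc z < 1 ->
          f z = z * zquot f z /\ cderiv f z = zquot f z + lam%:C * z * phi z].
Proof.
move=> [[fA [f0 f1]] [phi [pA [pB pE]]]]; exists phi.
  move=> z z1; split; first by apply/derivable_has_cderiv/pA; rewrite normr_lt1.
  by rewrite -lecR -normrC; apply: pB; rewrite normr_lt1.
have fd z : normc z < 1 -> has_cderiv f z (cderiv f z).
  by move=> z1; apply/derivable_has_cderiv/fA; rewrite normr_lt1.
split.
- by apply: ccontinuous_zquot0 => //; rewrite -f1; apply: fd; rewrite normc0.
- move=> z z0 z1.
  suff <- : (z * cderiv f z - f z) / z ^+ 2 = lam%:C * phi z.
    exact: has_cderiv_zquot (fd _ z1).
  by rewrite pE ?normr_lt1 // mulrAC mulfK // expf_neq0.
- move=> z z1; rewrite /zquot; have [->|z0] := eqVneq z 0.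
    by rewrite f0 f1 !mul0r mulr0 mul0r addr0.
  split; first by field; rewrite z0.
  have := pE z; rewrite normr_lt1 => /(_ z1) /(canRL (subrK _)) E.
  by apply: (mulfI z0); rewrite E; field; rewrite z0.
Qed.

Lemma Omega_zquot_bound (lam : R) f z : 0 < lam -> Omega lam f -> normc z < 1 ->
  normc (zquot f z - 1) <= lam * normc z.
Proof.
move=> l0 /Omega_zquot[phi phiP [q0 qd _]] z1.
have [->|z0] := eqVneq z 0; first by rewrite /zquot eqxx subrr normc0 mulr0.
have tz (t : R) : 0 <= t <= 1 -> normc (t%:C * z) < 1.
  move=> /andP[t0 t1]; apply: le_lt_trans z1.
  by rewrite normcM normc_real ger0_norm // ler_piMl ?normc_ge0.
have := @segment_mean_value _ (zquot f) (fun w => lam%:C * phi w) 0 z lam.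
rewrite add0r [zquot f 0]/zquot eqxx; apply => t /andP[t0 t1]; rewrite add0r.
  have [->|tz0] := eqVneq (t%:C * z) 0; first exact: q0.
  by apply: has_cderiv_ccontinuous; apply: qd => //; rewrite tz // t0 t1.
have tz1 : normc (t%:C * z) < 1 by rewrite tz // !ltW.
split; first by apply: qd => //; rewrite mulf_neq0 // (inj_eq (@complexI R)) gt_eqF.
rewrite normcM normc_real gtr0_norm // ler_piMr ?(ltW l0) //.
by have [] := phiP _ tz1.
Qed.

(* [zquot f - 1] is an antiderivative of [lam * phi], hence twice differentiable
   off [0], so [(zquot f z - 1) / z] obeys the maximum principle there. *)
Lemma Omega_extremal (lam : R) f z0 : 0 < lam -> Omega lam f ->
  z0 != 0 -> normc z0 < 1 -> normc (zquot f z0 - 1) = lam * normc z0 ->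
  exists eta : C, `|eta| = 1 /\
    forall w, `|w| < 1 -> f w = w + lam%:C * eta * w ^+ 2.
Proof.
move=> l0 Of z00 z01 E.
have nz0 : 0 < normc z0 by rewrite normc_gt0.
have lC : lam%:C != 0 :> C by rewrite (inj_eq (@complexI R)) gt_eqF.
pose s z := (zquot f z - 1) / (lam%:C * z).
have ns z : normc (s z) = normc (zquot f z - 1) / (lam * normc z).
  by rewrite /s normcM normcV normcM normc_real gtr0_norm.
have s0 : normc (s z0) = 1 by rewrite ns E divff // mulf_neq0 // gt_eqF.
have sn0 : s z0 != 0 by rewrite -normc_gt0 s0.
have s1 z : z != 0 -> normc z < 1 -> normc (s z) <= 1.
  move=> zn0 z1; rewrite ns ler_pdivrMr ?mulr_gt0 ?normc_gt0 // mul1r.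
  exact: Omega_zquot_bound.
exists (s z0); split; first by rewrite normrC s0.
(* The maximum principle controls only moduli. Averaging with [1] makes modulus [1] determine the
   value: in the closed unit disk, [|x + 1| = 2] holds only for [x = 1]. *)
pose H z := (s z / s z0 + 1) / 2.
have n2 : normc (2 : C) = 2.
  by rewrite -(rmorph_nat (real_complex R) 2) normc_real normr_nat.
have H1 z : z != 0 -> normc z < 1 -> normc (H z) <= 1.
  move=> zn0 z1; rewrite /H normcM normcV n2 ler_pdivrMr // mul1r.
  apply: le_trans (le_normcD _ _) _; rewrite normcM normcV s0 invr1 mulr1 normc1.
  by have := s1 _ zn0 z1; lra.
have H2 z : z != 0 -> normc z < 1 -> peano2 H z.
  move=> zn0 z1; have [phi phiP [_ qd _]] := Omega_zquot Of.
  have nz : 0 < normc z by rewrite normc_gt0.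
  have Q : peano2 (zquot f) z.
    (* A disk of this radius around [z] avoids [0] and stays inside the unit disk. *)
    have d0 : 0 < Num.min (normc z) (1 - normc z) by rewrite lt_min nz subr_gt0.
    apply: (@peano2_primitive _ _ _ (fun w => lam%:C * phi w) _ (lam%:C * cderiv phi z) d0).
      move=> w; rewrite lt_min => /andP[w1 w2]; apply: qd.
        by rewrite -[w](subrK z) addrC; exact: addr_normc_lt_neq0.
      by have := le_normcB w z; lra.
    have [pd _] := phiP _ z1.
    have := cvg0M (cvg0_cst lam%:C) pd.
    by apply: cvg0_eq ltr01 _ => h h0 _; rewrite -mulrBr mulrA.
  have Qs : peano2 (fun w => (zquot f w + -1) * (w - 0)^-1) z.
    by apply: peano2M (peano2_inv zn0); exact: peano2_add_cst.
  have QH := peano2M (peano2_add_cst 1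
    (peano2M Qs (peano2_affine (lam%:C^-1 * (s z0)^-1) 0 z))) (peano2_affine 2^-1 0 z).
  move: QH; congr (peano2 _ z); apply/funext => w.
  rewrite /H !mul0r !addr0 subr0; congr ((_ + 1) * _).
  by move: (s z0)^-1 => k; rewrite /s invfM !mulrA; ring.
have Hz0 : normc (H z0) = 1.
  by rewrite /H divff // (_ : (1 + 1) / 2 = 1 :> C) ?normc1 //; field.
move=> w; rewrite normr_lt1 => w1.
have [_ _ [_ _ /(_ _ w1)[-> _]]] := Omega_zquot Of.
have [->|w0] := eqVneq w 0; first by rewrite expr0n mul0r mulr0 addr0.
have := punctured_disk_maximum H1 H2 z00 z01 Hz0 w0 w1.
rewrite /H normcM normcV n2 => /(canRL (divfK _)); rewrite mul1r pnatr_eq0.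
move=> /(_ isT) Hw.
have : normc (s w / s z0) <= 1 by rewrite normcM normcV s0 invr1 mulr1 s1.
suff K (x : C) : normc (x + 1) = 2 -> normc x <= 1 -> x = 1.
  move=> /(K _ Hw) /(canRL (divfK sn0)); rewrite mul1r => <-.
  by rewrite /s; field; rewrite w0 lC.
move=> x1 x2; have := congr1 (fun t => t ^+ 2) x1; rewrite normc_sqr.
have : normc x ^+ 2 <= 1 by rewrite expr_le1 ?normc_ge0.
rewrite normc_sqr; case: (x) => a b /=; rewrite addr0 => ab1 ab2.
have a1 : a = 1 by nra.
by rewrite a1 in ab1 *; congr Complex; nra.
Qed.

(** Write [f z = z (1 + s)] and [f'(z) = 1 + s + lam z phi(z)]; both [s] and [lam z phi(z)] have
    modulus at most [lam |z|], so triangle inequalities suffice. *)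
Lemma Omega_bounds (lam : R) f z : 0 < lam -> Omega lam f -> normc z < 1 ->
  normc z - lam * normc z ^+ 2 <= normc (f z) <= normc z + lam * normc z ^+ 2 /\
  1 - 2 * lam * normc z <= normc (cderiv f z) <= 1 + 2 * lam * normc z.
Proof.
move=> l0 Of z1; have [phi phiP [_ _ /(_ _ z1)[-> ->]]] := Omega_zquot Of.
have B := Omega_zquot_bound l0 Of z1; have [_ p1] := phiP _ z1.
have n0 := normc_ge0 z.
rewrite -[zquot f z](subrK 1) [_ - 1 + 1]addrC; move: (zquot f z - 1) B => s B.
have T1 : normc (1 + s) <= 1 + normc s.
  by apply: le_trans (le_normcD _ _) _; rewrite normc1.
have T2 : 1 - normc s <= normc (1 + s).
  by have := le_normcB 1 (- s); rewrite opprK normc1 normcN.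
have P : normc (lam%:C * z * phi z) <= lam * normc z.
  by rewrite !normcM normc_real gtr0_norm // ler_piMr // mulr_ge0 // ltW.
have T3 := le_normcD (1 + s) (lam%:C * z * phi z).
have T4 := le_normcB (1 + s) (- (lam%:C * z * phi z)).
rewrite opprK normcN in T4.
split; last by apply/andP; split; lra.
rewrite normcM; apply/andP; split; nra.
Qed.

(** Equality in any of these triangle estimates leaves no slack in [|s| <= lam |z|], where
    [s = zquot f z - 1]. *)
Lemma Omega_equality (lam : R) f z : 0 < lam -> Omega lam f ->
  z != 0 -> normc z < 1 ->
  (normc (f z) = normc z - lam * normc z ^+ 2 \/
   normc (f z) = normc z + lam * normc z ^+ 2 \/
   normc (cderiv f z) = 1 - 2 * lam * normc z \/
   normc (cderiv f z) = 1 + 2 * lam * normc z) ->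
  normc (zquot f z - 1) = lam * normc z.
Proof.
move=> l0 Of z0 z1; have [phi phiP [_ _ /(_ _ z1)[-> ->]]] := Omega_zquot Of.
have B := Omega_zquot_bound l0 Of z1; have [_ p1] := phiP _ z1.
have n0 : 0 < normc z by rewrite normc_gt0.
rewrite -[in zquot f z + _](subrK 1 (zquot f z)) -[in z * _](subrK 1 (zquot f z)).
rewrite [_ - 1 + 1]addrC; move: (zquot f z - 1) B => s B.
have T1 : normc (1 + s) <= 1 + normc s.
  by apply: le_trans (le_normcD _ _) _; rewrite normc1.
have T2 : 1 - normc s <= normc (1 + s).
  by have := le_normcB 1 (- s); rewrite opprK normc1 normcN.
have P : normc (lam%:C * z * phi z) <= lam * normc z.
  by rewrite !normcM normc_real gtr0_norm // ler_piMr // mulr_ge0 // ltW.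
have T3 := le_normcD (1 + s) (lam%:C * z * phi z).
have T4 := le_normcB (1 + s) (- (lam%:C * z * phi z)).
rewrite opprK normcN in T4.
have cancel x : normc z * normc (1 + s) = normc z * x -> normc (1 + s) = x.
  by move=> /mulfI; apply; rewrite gt_eqF.
rewrite [normc (z * _)]normcM => -[E|[E|[E|E]]]; apply/eqP; rewrite eq_le B /=.
- have {}E : normc (1 + s) = 1 - lam * normc z by apply: cancel; rewrite E; ring.
  lra.
- have {}E : normc (1 + s) = 1 + lam * normc z by apply: cancel; rewrite E; ring.
  lra.
- lra.
- lra.
Qed.

(** With [q = f(z) / z], [z f'(z) / f(z) = 1 + lam z phi(z) / q]. Since [2 lam |z| < 1],
    [|q| >= 1 - lam |z| > lam |z|], so the added term has modulus below [1]. *)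
Lemma Omega_starlike (lam : R) f (r : R) : 0 < lam -> Omega lam f ->
  r <= 1 -> r <= 1 / (2 * lam) -> starlike_in_disk f r.
Proof.
move=> l0 Of r1 r2 z; rewrite normr_gt0 => z0; rewrite normrC ltcR => zr.
have z1 : normc z < 1 := lt_le_trans zr r1.
have z2 : normc z * (2 * lam) < 1.
  by rewrite -ltr_pdivlMr ?mulr_gt0 //; exact: lt_le_trans r2.
have [phi phiP [_ _ /(_ _ z1)[-> ->]]] := Omega_zquot Of.
have B := Omega_zquot_bound l0 Of z1; have [_ p1] := phiP _ z1.
have Bq := le_normcB 1 (1 - zquot f z).
rewrite subKr normc1 [normc (1 - _)]normc_distC in Bq.
move: (zquot f z) B Bq => q B Bq.
have q0 : 0 < normc q by lra.
have qn0 : q != 0 by rewrite -normc_gt0.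
have -> : z * (q + lam%:C * z * phi z) / (z * q) = 1 - (- (lam%:C * z * phi z / q)).
  by field; rewrite z0 qn0.
rewrite ReB subr_gt0 -[1]/((1 : R)%:C) Re_real_complex.
apply: le_lt_trans (Re_le_normc _) _; rewrite normcN normcM normcV ltr_pdivrMr //.
have : normc (lam%:C * z * phi z) <= lam * normc z.
  by rewrite !normcM normc_real gtr0_norm // ler_piMr // mulr_ge0 ?normc_ge0 // ltW.
lra.
Qed.

(** Used twice: to bound the supremum from below, and to show that its set is nonempty when bounding
    it from above. *)
Lemma Omega_starlike_radii (lam : R) f : 0 < lam -> Omega lam f ->
  [set g : R | 0 < g <= 1 /\ (forall r : R, 0 < r <= g -> starlike_in_disk f r)]
    (Num.min 1 (1 / (2 * lam))).
Proof.
move=> l0 Of.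
have m1 : Num.min 1 (1 / (2 * lam)) <= 1 by rewrite ge_min lexx.
have m2 : Num.min 1 (1 / (2 * lam)) <= 1 / (2 * lam) by rewrite ge_min lexx orbT.
split; first by rewrite m1 lt_min ltr01 divr_gt0 // mulr_gt0.
by move=> r /andP[_ rm]; apply: (Omega_starlike l0 Of); exact: le_trans rm _.
Qed.

Lemma gamma_star_ge (lam : R) f : 0 < lam -> Omega lam f ->
  Num.min 1 (1 / (2 * lam)) <= gamma_star f.
Proof.
move=> l0 Of; apply: ub_le_sup; first by exists 1 => g [/andP[]].
exact: Omega_starlike_radii.
Qed.

(* On the negative axis [z f'(z) / f(z) = (1 - 2 lam t) / (1 - lam t)] is negative
   for [1 / (2 lam) < t < 1 / lam]. *)
Lemma gamma_star_quadratic_le (lam : R) : 0 < lam ->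
  gamma_star (fun w : C => w + lam%:C * 1 * w ^+ 2) <= Num.min 1 (1 / (2 * lam)).
Proof.
move=> l0; have Of := @Omega_quadratic lam 1 (normr1 _).
set f := fun w : C => _.
have l20 : 0 < 2 * lam by lra.
apply: ge_sup.
  by exists (Num.min 1 (1 / (2 * lam))); exact: Omega_starlike_radii.
move=> g [/andP[g0 g1] Hg]; rewrite le_min g1 /= leNgt; apply/negP => gl.
(* The midpoint lies below [g] and strictly inside the interval where the quotient is negative. *)
pose t := (1 / (2 * lam) + Num.min g (1 / lam)) / 2.
have [tg t1 t2] : [/\ t < g, 1 < 2 * lam * t & lam * t < 1].
  have u1 : Num.min g (1 / lam) <= g by rewrite ge_min lexx.
  have u2 : Num.min g (1 / lam) <= 1 / lam by rewrite ge_min lexx orbT.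
  have u3 : 1 / (2 * lam) < Num.min g (1 / lam).
    by rewrite lt_min gl /= ltr_pM2l // ltf_pV2 ?posrE //; lra.
  have e1 : 2 * lam * (1 / (2 * lam)) = 1 by field; rewrite gt_eqF.
  have e2 : lam * (1 / lam) = 1 by field; rewrite gt_eqF.
  split; first by rewrite /t; lra.
    have : 1 / (2 * lam) < t by rewrite /t; lra.
    by rewrite -(ltr_pM2l l20 (1 / (2 * lam))) e1.
  have : t < 1 / lam by rewrite /t; lra.
  by rewrite -(ltr_pM2l l0 t) e2.
clearbody t.
have t0 : 0 < t by rewrite -(pmulr_rgt0 _ l20); lra.
have nt : normc (- t%:C : C) = t by rewrite normcN normc_real gtr0_norm.
have gg : 0 < g <= g by rewrite g0 lexx.
have := Hg _ gg (- t%:C); rewrite normrC nt !ltcR => /(_ t0 tg).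
rewrite /f cderiv_quadratic.
have T0 : - t%:C != 0 :> C by rewrite -normc_gt0 nt.
have -> : - t%:C + lam%:C * 1 * (- t%:C) ^+ 2 = - t%:C * (1 - lam * t)%:C :> C.
  by rewrite rmorphB rmorphM rmorph1 /=; ring.
have -> : 1 + 2 * (lam%:C * 1) * - t%:C = (1 - 2 * lam * t)%:C :> C.
  by rewrite rmorphB !rmorphM rmorph1 rmorph_nat /=; ring.
rewrite -mulf_div divff // mul1r -fmorphV -rmorphM /=.
rewrite pmulr_lgt0 ?invr_gt0; lra.
Qed.

(** The infimum is attained at [w + lam w^2]. *)
Lemma radius_starlike_Omega (lam : R) : 0 < lam ->
  radius_starlike (@Omega R lam) = Num.min 1 (1 / (2 * lam)).
Proof.
move=> l0; have Of := @Omega_quadratic lam 1 (normr1 _).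
apply/eqP; rewrite eq_le; apply/andP; split.
  apply: le_trans (gamma_star_quadratic_le l0).
  apply: ge_inf; last by exists (fun w : C => w + lam%:C * 1 * w ^+ 2).
  by exists (Num.min 1 (1 / (2 * lam))) => _ [f Hf <-]; exact: gamma_star_ge.
apply: lb_le_inf; first by eexists; exists (fun w : C => w + lam%:C * 1 * w ^+ 2).
by move=> _ [f Hf <-]; exact: gamma_star_ge.
Qed.

End OmegaClass.

(** * Assembly of the theorem *)

Unset Implicit Arguments.

Theorem theorem4p1 (R : realType) (lam : R) (hlam : 0 < lam) :
  (* radius of starlikeness (capped at 1, since members live on the unit disk) *)
  radius_starlike (@Omega R lam) = Num.min 1 (1 / (2 * lam))
  /\
  (forall f : R[i] -> R[i], Omega lam f ->
     (forall z : R[i], `|z| < 1 ->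
        `|z| - lam%:C * `|z| ^+ 2 <= `|f z| <= `|z| + lam%:C * `|z| ^+ 2 /\
        1 - 2 * lam%:C * `|z| <= `|cderiv f z| <= 1 + 2 * lam%:C * `|z|)
     /\
     (* equality case: equality at some z <> 0 in any of the bounds forces
        f to be an extremal function *)
     (forall z : R[i], `|z| < 1 -> z != 0 ->
        (`|f z| = `|z| - lam%:C * `|z| ^+ 2 \/
         `|f z| = `|z| + lam%:C * `|z| ^+ 2 \/
         `|cderiv f z| = 1 - 2 * lam%:C * `|z| \/
         `|cderiv f z| = 1 + 2 * lam%:C * `|z|) ->
        exists eta : R[i], `|eta| = 1 /\
          forall w : R[i], `|w| < 1 -> f w = w + lam%:C * eta * w ^+ 2))
  /\
  (* conversely, the extremal functions belong to Omega_lambda and attain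
     equality in both (upper, resp. lower) bounds at any given z <> 0 *)
  (forall eta : R[i], `|eta| = 1 ->
     Omega lam (fun w => w + lam%:C * eta * w ^+ 2))
  /\
  (forall z : R[i], `|z| < 1 -> z != 0 ->
     (exists eta : R[i], `|eta| = 1 /\
        let g := fun w => w + lam%:C * eta * w ^+ 2 in
        `|g z| = `|z| + lam%:C * `|z| ^+ 2 /\
        `|cderiv g z| = 1 + 2 * lam%:C * `|z|)
     /\
     (2 * lam%:C * `|z| <= 1 ->
      exists eta : R[i], `|eta| = 1 /\
        let g := fun w => w + lam%:C * eta * w ^+ 2 in
        `|g z| = `|z| - lam%:C * `|z| ^+ 2 /\
        `|cderiv g z| = 1 - 2 * lam%:C * `|z|)).
Proof.
split; first exact: radius_starlike_Omega.
(* The norm takes values in [R[i]]; writing every bound as an embedded real moves the comparisons to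
   [R]. *)
have sqE (z : R[i]) : lam%:C * `|z| ^+ 2 = (lam * normc z ^+ 2)%:C.
  by rewrite normrC rmorphM rmorphXn.
have dE (z : R[i]) : 2 * lam%:C * `|z| = (2 * lam * normc z)%:C.
  by rewrite normrC !rmorphM rmorph_nat.
have oneE : 1 = (1 : R)%:C by [].
have BD (x y : R) : x%:C - y%:C = (x - y)%:C /\ x%:C + y%:C = (x + y)%:C.
  by rewrite rmorphB rmorphD.
split.
  move=> f Of; split.
    move=> z; rewrite normr_lt1 => /(Omega_bounds hlam Of).
    by rewrite sqE dE !normrC oneE !(BD _ _).1 !(BD _ _).2 !lecR.
  move=> z; rewrite normr_lt1 => z1 z0 E.
  apply: (Omega_extremal hlam Of z0 z1); apply: (Omega_equality hlam Of z0 z1).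
  move: E; rewrite sqE dE !normrC oneE !(BD _ _).1 !(BD _ _).2.
  by move=> [/complexI|[/complexI|[/complexI|/complexI]]] ->; tauto.
split; first exact: Omega_quadratic.
move=> z z1 z0.
(* This rotation gives [eta * z = |z|], aligning the quadratic term with [z] for the upper bounds;
   [- eta] opposes it for the lower ones. *)
pose eta : R[i] := `|z| / z.
have eta1 : `|eta| = 1 by rewrite /eta normrM normfV normr_id divff ?normr_eq0.
have etaE : eta * z = `|z| by rewrite /eta divfK.
split=> [|z2].
  exists eta; split=> //=; rewrite cderiv_quadratic.
  have -> : z + lam%:C * eta * z ^+ 2 = z * (1 + lam%:C * (eta * z)) by ring.
  have -> : 1 + 2 * (lam%:C * eta) * z = 1 + 2 * lam%:C * (eta * z) by ring.
  have l0 : 0 <= lam%:C * `|z| by rewrite mulr_ge0 ?normr_ge0 // lecR ltW.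
  have l1 : 0 <= 1 + lam%:C * `|z| by rewrite addr_ge0.
  have l2 : 0 <= 1 + 2 * lam%:C * `|z| by rewrite addr_ge0 // -mulrA mulr_ge0.
  rewrite etaE normrM (ger0_norm l1) (ger0_norm l2).
  by split=> //; ring.
exists (- eta); split; first by rewrite normrN.
rewrite /= cderiv_quadratic.
have -> : z + lam%:C * - eta * z ^+ 2 = z * (1 - lam%:C * (eta * z)) by ring.
have -> : 1 + 2 * (lam%:C * - eta) * z = 1 - 2 * lam%:C * (eta * z) by ring.
have l0 : 0 <= lam%:C * `|z| by rewrite mulr_ge0 ?normr_ge0 // lecR ltW.
(* Both [1 - lam |z|] and [1 - 2 lam |z|] must be nonnegative for their moduli to equal the lower
   bounds. *)
have z3 : lam%:C * `|z| <= 1.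
  by apply: le_trans z2; rewrite -mulrA mulr_natl mulr2n lerDl.
rewrite -subr_ge0 in z2; rewrite -subr_ge0 in z3.
rewrite etaE normrM (ger0_norm z2) (ger0_norm z3).
by split=> //; ring.
Qed.
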